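(* With $(y)_n$ denoting the number of permutations in $F_n(321,1423)$ with label $(y)$, the following hold. (i) For all $n\ge 2$, $(1)_n=F_n-n+1$. (ii) For all $n\ge 3$, $(2b)_n=n-3$. (iii) For all $n\ge 3$, $(2c)_n=1$. (iv) For all $n\ge 0$, $(2d)_n=F_{n+1}-n-1$. (v) For all $n\ge 2$, $(3)_n=1$. (vi) For all $n\ge 0$, $|F_n(321,1423)|=F_{n+2}-n-1$.
   Context: $F_n$ (without arguments) is the Fibonacci number with $F_0=F_1=1$ and $F_n=F_{n-1}+F_{n-2}$ for $n\ge2$. A Fishburn permutation is a permutation $\pi$ (in one-line notation) with no subsequence $\pi_j,\pi_{j+1},\pi_k$ such that $j+1<k$, $\pi_j=\pi_k+1$, and $\pi_{j+1}>\pi_j$. $F_n(321,1423)$ is the set of Fishburn permutations of length $n$ avoiding the classical patterns $321$ and $1423$ (i.e. having no subsequence with the same relative order as either). A descent of $\pi$ is a pair of adjacent entries $\pi_j>\pi_{j+1}$. Labels: for $n\ge1$, a permutation $\pi\in F_n(321,1423)$ has label (1) if $n\ge2$, $\pi_{n-1}=n$ and $\pi_n=n-1$; (2a) if $\pi=1$; (2b) if $n\ge4$, $\pi_{n-1}=n$ and $\pi_n=k$ where $1<k<n-1$; (2c) if $n\ge3$ and the rightmost $k+2$ entries of $\pi$ are $n,1,2,\ldots,k,n-1$ for some $k$ with $1\le k\le n-2$; (2d) if $\pi_n=n$ and $\pi$ has a descent; (3) if $n\ge2$ and $\pi$ has no descents. The empty permutation has none of these labels. *)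

(* Defs.v *)
From mathcomp Require Import all_boot all_order all_algebra all_fingroup.

Set Implicit Arguments.
Unset Strict Implicit.
Unset Printing Implicit Defensive.

(* Indexed so that fib 0 = fib 1 = 1. *)
Fixpoint fib (n : nat) : nat :=
  match n with
  | 0 => 1
  | n'.+1 => match n' with
             | 0 => 1
             | n''.+1 => fib n' + fib n''
             end
  end.

(* 'S_n permutes {0, .., n-1}; the one-line word shifts the values to
   {1, .., n}. *)
Definition oneline (n : nat) (s : 'S_n) : seq nat := [seq (s i).+1 | i : 'I_n].

(* The entry pi_j, with positions counted from 1. *)
Definition entry (n : nat) (s : 'S_n) (j : nat) : nat :=
  nth 0 (oneline s) j.-1.

Definition same_order (u v : seq nat) : bool :=
  (size u == size v) &&
  [forall i : 'I_(size u), forall j : 'I_(size u),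
     (nth 0 u i < nth 0 u j) == (nth 0 v i < nth 0 v j)].

(* The bit vector m selects a subsequence of the one-line word. *)
Definition contains (n : nat) (s : 'S_n) (p : seq nat) : bool :=
  [exists m : n.-tuple bool, same_order (mask m (oneline s)) p].

Definition avoids (n : nat) (s : 'S_n) (p : seq nat) : bool :=
  ~~ contains s p.

(* Only relative positions matter here, so they are counted from 0. *)
Definition fishburn (n : nat) (s : 'S_n) : bool :=
  let w := oneline s in
  ~~ [exists j : 'I_n, exists k : 'I_n,
        [&& j.+1 < k, nth 0 w j == (nth 0 w k).+1
          & nth 0 w j.+1 > nth 0 w j]].

Definition fishburn_321_1423 (n : nat) : {set 'S_n} :=
  [set s : 'S_n | [&& fishburn s, avoids s [:: 3; 2; 1]
                    & avoids s [:: 1; 4; 2; 3]]].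

Definition has_descent (n : nat) (s : 'S_n) : bool :=
  let w := oneline s in
  [exists j : 'I_n, (j.+1 < n) && (nth 0 w j > nth 0 w j.+1)].

Inductive label := L1 | L2a | L2b | L2c | L2d | L3.

Definition has_label (y : label) (n : nat) (s : 'S_n) : bool :=
  match y with
  | L1 => [&& 2 <= n, entry s n.-1 == n & entry s n == n.-1]
  | L2a => oneline s == [:: 1]
  | L2b => [&& 4 <= n, entry s n.-1 == n & 1 < entry s n < n.-1]
  | L2c => (3 <= n) &&
      [exists k : 'I_n,
         (1 <= k <= n - 2) &&
         (drop (n - (k + 2)) (oneline s) == n :: rcons (iota 1 k) n.-1)]
  | L2d => [&& 1 <= n, entry s n == n & has_descent s]
  | L3 => (2 <= n) && ~~ has_descent s
  end.

Definition label_count (y : label) (n : nat) : nat :=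
  #|[set s in fishburn_321_1423 n | has_label y s]|.

(* Main.v *)
Require Import Defs.
From mathcomp Require Import all_boot all_order all_algebra all_fingroup.
From mathcomp Require Import zify.

(* Look at the entry n of such a permutation.  If it comes last, or is followed
   only by n-1, deleting it (together with n-1) leaves an arbitrary member of
   the family of length n-1 (resp. n-2).  If it is followed by a single
   c < n-1, the Fishburn condition on c+1 and c forces the word
   c+1, 1, .., c-1, c+2, .., n, c.  If at least two entries follow it, it must
   be first and the word is n, 1, .., n-1.  Hence
   |F_n| = |F_{n-1}| + |F_{n-2}| + (n-3) + 1 for n >= 3. *)

Set Implicit Arguments.
Unset Strict Implicit.
Unset Printing Implicit Defensive.

(** * Pattern conditions as inequalities between positions *)

(* [f i] stands for the entry at position i, counted from 0. *)
Definition good (n : nat) (f : nat -> nat) : Prop :=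
  [/\ forall j k, j.+1 < k -> k < n -> f j = (f k).+1 -> f j.+1 <= f j,
      forall i j k, i < j -> j < k -> k < n -> f j < f i -> f j <= f k
    & forall i j k l, i < j -> j < k -> k < l -> l < n ->
        f i < f k -> f k < f l -> f j <= f l].

(** Used to replace a word by a closed formula for its entries, and to pass between a word and its
    extensions. *)
Lemma eq_good n f g : (forall i, i < n -> f i = g i) -> good n f -> good n g.
Proof.
move=> fg [F A B]; split.
- move=> j k jk kn; rewrite -!fg; [exact: F | lia..].
- move=> i j k ij jk kn; rewrite -!fg; [exact: A | lia..].
- move=> i j k l ij jk kl ln; rewrite -!fg; [exact: B | lia..].
Qed.

Lemma good_leq m n f : m <= n -> good n f -> good m f.
Proof.
move=> mn [F A B]; split.
- move=> j k jk kn; apply: F; lia.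
- move=> i j k ij jk kn; apply: A; lia.
- move=> i j k l ij jk kl ln; apply: B; lia.
Qed.

Lemma size_oneline n (s : 'S_n) : size (oneline s) = n.
Proof. by rewrite size_map -cardE card_ord. Qed.

Lemma mask_nth_iota (m : bitseq) (w : seq nat) :
  mask m w = map (nth 0 w) (mask m (iota 0 (size w))).
Proof. by rewrite map_mask map_nth_iota0 // take_size. Qed.

(** A mask amounts to a strictly increasing list of positions, which turns avoidance into the
    conditions of [good]. *)
Lemma containsP n (s : 'S_n) p :
  reflect (exists idx, [/\ sorted ltn idx, all (fun i => i < n) idx
             & same_order (map (nth 0 (oneline s)) idx) p])
          (contains s p).
Proof.
apply: (iffP existsP) => [[m Hm]|[idx [idx_s idx_n Hp]]].
  exists (mask m (iota 0 n)); split.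
  - by apply: sorted_mask; [exact: ltn_trans | exact: iota_ltn_sorted].
  - by apply/allP => i /mem_mask; rewrite mem_iota.
  - by rewrite -[in iota _ _](size_oneline s) -mask_nth_iota.
(* The mask is the indicator of membership in [idx]. Filtering all positions by it gives back [idx],
   since both lists are strictly increasing with the same members. *)
have sz : size [seq i \in idx | i <- iota 0 n] == n by rewrite size_map size_iota.
exists (Tuple sz); rewrite mask_nth_iota size_oneline /= -filter_mask.
rewrite (_ : filter _ _ = idx) //.
apply: (irr_sorted_eq ltn_trans ltnn) => //.
  by apply: sorted_filter; [exact: ltn_trans | exact: iota_ltn_sorted].
move=> i; rewrite mem_filter mem_iota /=; case: (boolP (i \in idx)) => //= ii.
by rewrite add0n (allP idx_n).
Qed.

Lemma same_order321 u : same_order u [:: 3; 2; 1] <->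
  exists a b c, [/\ u = [:: a; b; c], b < a & c < b].
Proof.
split=> [/andP[/eqP sz /forallP H]|[a [b [c [-> ba cb]]]]].
  case: u sz H => [|a [|b [|c []]]] //= _ H; exists a, b, c; split=> //.
    by have /forallP/(_ ord0)/eqP := H (@Ordinal 3 1 isT).
  by have /forallP/(_ (@Ordinal 3 1 isT))/eqP := H (@Ordinal 3 2 isT).
apply/andP; split=> //; apply/forallP => i; apply/forallP => j.
by case: i => [[|[|[|//]]] /= ?]; case: j => [[|[|[|//]]] /= ?]; lia.
Qed.

Lemma same_order1423 u : same_order u [:: 1; 4; 2; 3] <->
  exists a b c d, [/\ u = [:: a; b; c; d], a < c, c < d & d < b].
Proof.
split=> [/andP[/eqP sz /forallP H]|[a [b [c [d [-> ac cd db]]]]]].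
  case: u sz H => [|a [|b [|c [|d []]]]] //= _ H; exists a, b, c, d; split=> //.
  - by have /forallP/(_ (@Ordinal 4 2 isT))/eqP := H ord0.
  - by have /forallP/(_ (@Ordinal 4 3 isT))/eqP := H (@Ordinal 4 2 isT).
  - by have /forallP/(_ (@Ordinal 4 1 isT))/eqP := H (@Ordinal 4 3 isT).
apply/andP; split=> //; apply/forallP => i; apply/forallP => j.
by case: i => [[|[|[|[|//]]]] /= ?]; case: j => [[|[|[|[|//]]]] /= ?]; lia.
Qed.

Lemma goodP n (s : 'S_n) :
  reflect (good n (nth 0 (oneline s))) (s \in fishburn_321_1423 n).
Proof.
rewrite inE; apply: (iffP and3P) => [[F A B]|[F A B]]; split.
- move=> j k jk kn e; rewrite leqNgt; apply: contra F => lt.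
  have jn : j < n by lia.
  apply/existsP; exists (Ordinal jn); apply/existsP; exists (Ordinal kn).
  by rewrite /= jk e eqxx -e lt.
- move=> i j k ij jk kn lt; rewrite leqNgt; apply: contra A => lt'.
  apply/containsP; exists [:: i; j; k]; split=> /=; [lia|lia|].
  by apply/same_order321; do 3!eexists; split.
- move=> i j k l ij jk kl ln lt lt1; rewrite leqNgt; apply: contra B => lt'.
  apply/containsP; exists [:: i; j; k; l]; split=> /=; [lia|lia|].
  by apply/same_order1423; do 4!eexists; split.
- apply/existsP => -[j /existsP[k /and3P[jk /eqP e lt]]].
  by have := F _ _ jk (ltn_ord k) e; lia.
- apply/containsP => -[idx [so al /same_order321 [a [b [c []]]]]].
  case: idx so al => [|i [|j [|k []]]] //= so al [<- <- <-].
  by have := A i j k; lia.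
- apply/containsP => -[idx [so al /same_order1423 [a [b [c [d []]]]]]].
  case: idx so al => [|i [|j [|k [|l []]]]] //= so al [<- <- <- <-].
  by have := B i j k l; lia.
Qed.

(** * One-line words as rearrangements of 1, .., n *)

Lemma oneline_inj n : injective (@oneline n).
Proof.
move=> s t /eq_in_map st; apply/permP => i; apply: val_inj.
by have [] := st i (mem_enum _ i).
Qed.

Lemma nth_oneline n (s : 'S_n) (i : 'I_n) : nth 0 (oneline s) i = (s i).+1.
Proof. by rewrite (nth_map i) ?nth_ord_enum // size_enum_ord. Qed.

Lemma mem_iota1 (n x : nat) : (x \in iota 1 n) = (0 < x <= n).
Proof. by rewrite mem_iota add1n ltnS. Qed.

(** Pigeonhole: n distinct values in a range of n values exhaust it. *)
Lemma uniq_range_perm n (w : seq nat) : size w = n -> uniq w ->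
  (forall i, i < n -> 0 < nth 0 w i <= n) -> perm_eq w (iota 1 n).
Proof.
move=> sz uw rg; apply: uniq_perm => //; first exact: iota_uniq.
have sub : {subset w <= iota 1 n}.
  by move=> x /(nthP 0) [i]; rewrite sz => /rg + <-; rewrite mem_iota1.
by case: (uniq_min_size uw sub); rewrite ?size_iota ?sz.
Qed.

(** With [oneline_inj], this allows words to be counted in place of permutations. *)
Lemma onelineP n (w : seq nat) :
  reflect (exists s : 'S_n, w = oneline s) (perm_eq w (iota 1 n)).
Proof.
apply: (iffP idP) => [pw|[s ->]]; last first.
  apply: uniq_range_perm; first exact: size_oneline.
    by rewrite map_inj_uniq ?enum_uniq // => i j [/val_inj/perm_inj].
  move=> i lt; rewrite (nth_oneline s (Ordinal lt)).
  exact: ltn_ord.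
have sz : size w = n by rewrite (perm_size pw) size_iota.
have uw : uniq w by rewrite (perm_uniq pw) iota_uniq.
have rg i : i < n -> 0 < nth 0 w i <= n.
  by move=> lt; rewrite -mem_iota1 -(perm_mem pw) mem_nth ?sz.
(* The default [i] is never taken: entries lie in 1, .., n, so their predecessors are below n. *)
pose f (i : 'I_n) : 'I_n := insubd i (nth 0 w i).-1.
have fE i : (f i).+1 = nth 0 w i.
  have := rg i (ltn_ord i); rewrite val_insubd; have := ltn_ord i.
  by case: ifP; lia.
have fI : injective f.
  move=> i j e; apply: val_inj; apply/eqP.
  by rewrite -(nth_uniq 0 _ _ uw) ?sz ?ltn_ord // -!fE e.
exists (perm fI); apply: (@eq_from_nth _ 0); rewrite ?size_oneline // sz => i lt.
by rewrite (nth_oneline _ (Ordinal lt)) permE fE.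
Qed.

Lemma increasing_id m (h : nat -> nat) :
  (forall i j, i < j -> j < m -> h i < h j) ->
  (forall i, i < m -> 0 < h i <= m) -> forall i, i < m -> h i = i.+1.
Proof.
move=> inc rg i im.
(* Growth by at least 1 per step, applied from 0 to i and from i to m-1, bounds [h i] from below and
   from above by i+1. *)
have gap d a : a + d < m -> h a + d <= h (a + d).
  elim: d => [|d IH] lt; first by rewrite !addn0.
  by have := inc (a + d) (a + d.+1); lia.
have := gap i 0; have := gap (m - i.+1) i.
have := rg 0; have := rg (i + (m - i.+1)); rewrite add0n; lia.
Qed.

(** * Structure of a good word by the position of its maximum *)

Lemma perm_iota_size n w : perm_eq w (iota 1 n) -> size w = n.
Proof. by move=> /perm_size; rewrite size_iota. Qed.

Lemma perm_iota_range n w i :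
  perm_eq w (iota 1 n) -> i < n -> 0 < nth 0 w i <= n.
Proof.
by move=> pw lt; rewrite -mem_iota1 -(perm_mem pw) mem_nth ?(perm_iota_size pw).
Qed.

(** For 1 < c < n-1 this is the word c+1, 1, .., c-1, c+2, .., n, c, with positions counted from
    0. *)
Definition label2b_word (n c : nat) : seq nat :=
  mkseq (fun i => if i == 0 then c.+1 else if i == n.-1 then c
                  else if i < c then i else i.+2) n.

Section Structure.
Variables (n : nat) (w : seq nat).
Hypothesis perm_w : perm_eq w (iota 1 n).
Hypothesis good_w : good n (nth 0 w).
Local Notation f := (nth 0 w).
Let g (v : nat) : nat := index v w.

Let size_w : size w = n.
Proof. exact: perm_iota_size. Qed.

Let range_f i : i < n -> 0 < f i <= n.
Proof. exact: perm_iota_range. Qed.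

Let fK i : i < n -> g (f i) = i.
Proof.
by move=> lt; rewrite /g index_uniq ?size_w // (perm_uniq perm_w) iota_uniq.
Qed.

Let inv_f v : 0 < v <= n -> g v < n /\ f (g v) = v.
Proof.
move=> rg; have vw : v \in w by rewrite (perm_mem perm_w) mem_iota1.
by rewrite /g nth_index // -[X in _ < X]size_w index_mem.
Qed.

Let f_inj i j : i < n -> j < n -> f i = f j -> i = j.
Proof. by move=> /fK {2}<- /fK {2}<- ->. Qed.

(** Avoiding 321 makes the entries after n increase. Avoiding 1423 and the Fishburn condition then
    leave no room for an entry before n. *)
Lemma max_early : 2 < n -> index n w < n - 2 -> w = n :: iota 1 n.-1.
Proof.
rewrite -/(g n); case: good_w => F A B n2 p_n.
have [|_ fp] := @inv_f n; first by lia.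
move: fp p_n; set p := g n => fp p_n.
have lt_n i : i < n -> i <> p -> f i < n.
  by move=> lt ne; have := @f_inj i p; have := range_f lt; lia.
have incr i j : p < i -> i < j -> j < n -> f i < f j.
  move=> pi ij jn; have := A p i j pi ij jn.
  by have := @f_inj i j; have := lt_n i; lia.
(* Otherwise positions a, p, i, n-1 carry a 1423, with n as its 4. *)
have before a i : a < p -> p < i -> i < n.-1 -> f i < f a.
  move=> ap pi lt; have := B a p i n.-1 ap pi lt.
  have := incr i n.-1; have := @f_inj a i; have := lt_n n.-1; lia.
pose k := f (n - 2).
have kn : k < f n.-1 by apply: incr; lia.
have fn : f n.-1 < n by apply: lt_n; lia.
(* If v+1 precedes n and v follows n, the Fishburn condition bounds the entry right after v+1 by
   v+1; but that entry is n or another entry above v. *)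
have before_gt a i v : a < p -> p < i -> i < n -> f i = v -> f a = v.+1 ->
    (forall b, b < p -> v < f b) -> False.
  move=> ap pi lt fi fa gt; have := F a i; have := lt_n a; rewrite fi fa.
  have := @f_inj a a.+1; have [e|ne] := eqVneq a.+1 p; first by rewrite e fp; lia.
  by have := gt a.+1; lia.
(* The value k+1 is not before n, by [before_gt]; after n, the increase leaves it only the last
   position. *)
have fnk : f n.-1 = k.+1.
  have [|ltg fg] := @inv_f k.+1; first by lia.
  move: ltg fg; set q := g _ => ltg fg.
  have [qp|pq|e] := ltngtP q p.
  - case: (@before_gt q (n - 2) k) => //; try lia.
    by move=> b bp; apply: before => //; lia.
  - have := incr q (n - 2); have := incr (n - 2) q; rewrite -/k.
    have [e|e] := eqVneq q (n - 2); first by move: fg; rewrite e -/k; lia.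
    have [e'|e'] := eqVneq q n.-1; first by rewrite -e' fg.
    lia.
  - by move: fg; rewrite e fp; lia.
(* Entries before n would all exceed k+1, so k+2 < n. The value k+2 is then neither before n, by
   [before_gt], nor after it, where k+1 is the largest entry. *)
have p0 : p = 0.
  apply/eqP; rewrite -leqn0 leqNgt; apply/negP => p_gt0.
  have gt b : b < p -> k.+1 < f b.
    move=> bp; have := before b (n - 2) bp; rewrite -/k.
    by have := @f_inj b n.-1; lia.
  have := gt 0 p_gt0; have := lt_n 0; move=> l1 l2.
  have [|ltg fg] := @inv_f k.+2; first by lia.
  move: ltg fg; set q := g _ => ltg fg.
  have [qp|pq|e] := ltngtP q p.
  - by case: (@before_gt q n.-1 k.+1) => //; lia.
  - have := incr q n.-1; have [e|e] := eqVneq q n.-1; last by lia.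
    by move: fg; rewrite e; lia.
  - by move: fg; rewrite e fp; lia.
have fS : forall i, i < n.-1 -> f i.+1 = i.+1.
  apply: (@increasing_id _ (fun i => f i.+1)).
    by move=> i j ij jn; apply: incr; lia.
  by move=> i lt; have := lt_n i.+1; have := @range_f i.+1; lia.
apply: (@eq_from_nth _ 0); first by rewrite /= size_w size_iota; lia.
rewrite size_w => -[|i] lt /=; first by rewrite -[RHS]fp p0.
by rewrite nth_iota ?fS; lia.
Qed.

(** Let c be the last entry. The Fishburn condition on c+1 and c makes c+1 be followed by an entry
    below c. From this, c+1 is shown to be first and 1 second, and then the entries below c to
    precede those above c+1, both in increasing order. *)
Lemma max_penultimate : 1 < n -> f n.-2 = n -> f n.-1 < n.-1 ->
  1 < f n.-1 /\ w = label2b_word n (f n.-1).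
Proof.
case: good_w => F A B n1 fn2; set c := f n.-1 => cn.
have c_gt0 : 0 < c by have := @range_f n.-1; lia.
have ne_c i : i < n.-1 -> f i <> c.
  by move=> lt; have := @f_inj i n.-1; rewrite -/c; lia.
have [|p_n fp] := @inv_f c.+1; first by lia.
move: p_n fp; set p := g c.+1 => p_n fp.
have pn : p < n.-2.
  have [e|e] := eqVneq p n.-2; first by move: fp; rewrite e; lia.
  have [e'|e'] := eqVneq p n.-1; first by move: fp; rewrite e' -/c; lia.
  lia.
have fp1 : f p.+1 < c.
  have := F p n.-1; rewrite fp -/c; have := @ne_c p.+1.
  by have := @f_inj p p.+1; rewrite fp; lia.
have pn' : p.+1 < n.-2.
  by have [e|e] := eqVneq p.+1 n.-2; [move: fp1; rewrite e; lia | lia].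
(* A descent among these entries would form a 321 with the final c; in [small_incr], a descent forms
   a 321 with the earlier c+1. *)
have big_incr i j : i < j -> j < n.-1 -> c < f i -> c < f j -> f i < f j.
  move=> ij jn ci cj; have := A i j n.-1 ij jn; rewrite -/c.
  by have := @f_inj i j; lia.
have small_incr i j : p < i -> i < j -> j < n -> f i < c.+1 -> f i < f j.
  move=> pi ij jn ci; have := A p i j pi ij jn; rewrite fp.
  by have := @f_inj i j; have := @f_inj p j; rewrite fp; lia.
have before_p a : a < p -> f a < c.
  move=> ap; have := big_incr a p ap; have := ne_c a; have := @f_inj a p.
  by rewrite fp; lia.
(* Otherwise positions a, p, i, n-1 carry a 1423, with c+1 as its 4 and c as its 3. *)
have before_gt a i : a < p -> p < i -> i < n.-1 -> f i < c -> f i < f a.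
  move=> ap pi lt fi; have := B a p i n.-1 ap pi lt; rewrite fp -/c.
  by have := @f_inj a i; lia.
(* Induction on v. The value 1 cannot precede c+1 by [before_gt]. If v+1 preceded c+1 while v
   followed it, the entry right after v+1 would be c+1 or another entry above v, hence above v+1,
   against the Fishburn condition. *)
have after v : 0 < v -> v < c -> p < g v.
  elim: v => // v IH _ vc; have [|ltg fg] := @inv_f v.+1; first by lia.
  move: ltg fg; set a := g v.+1 => ltg fg.
  have [//|ap|e] := ltngtP p a; last by move: fg; rewrite -e fp; lia.
  have [v0|v_gt0] := posnP v.
    by have := before_gt a p.+1 ap; have := @range_f p.+1; lia.
  have pv := IH v_gt0 (ltnW vc).
  have [|ltv fv] := @inv_f v; first by lia.
  have vn : g v < n.-1.
    have [e|e] := eqVneq (g v) n.-1; last by lia.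
    by move: fv; rewrite e -/c; lia.
  have := F a (g v); rewrite fv fg; have := @f_inj a a.+1; rewrite fg.
  have [e|e] := eqVneq a.+1 p; first by rewrite e fp; lia.
  by have := before_gt a.+1 (g v); rewrite fv; lia.
(* Otherwise the first entry is a value below c placed before c+1. *)
have p0 : p = 0.
  apply/eqP; rewrite -leqn0 leqNgt; apply/negP => p_gt0.
  have := after (f 0); rewrite fK ?(ltnW n1) //; have := before_p 0 p_gt0.
  by have := @range_f 0; lia.
clearbody p; subst p.
have f1 : f 1 = 1.
  have [|lt1 fg1] := @inv_f 1; first by lia.
  have := after 1; have := small_incr 1 (g 1); rewrite fg1.
  have [e|e] := eqVneq (g 1) 1; first by rewrite -[in LHS]e.
  by have := @range_f 1; lia.
have c1 : 1 < c by lia.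
split=> //.
(* Otherwise 1, [f x], [f i] and the final c form a 1423. *)
have no_desc x i : 1 < x -> x < i -> i < n.-1 -> f i < c -> f x < c.
  move=> x1 xi lt fi; have := B 1 x i n.-1 x1 xi lt; rewrite f1 -/c.
  by have := @range_f i; have := @f_inj 1 i; have := ne_c x; rewrite f1; lia.
have ne_c1 i : 0 < i -> i < n -> f i <> c.+1.
  by move=> i0 lt; have := @f_inj i 0; rewrite fp; lia.
(* Closing the gap left by the values c and c+1 renumbers the n-2 middle entries into 1, .., n-2;
   being increasing, they are then determined by [increasing_id]. *)
pose h i := if f i.+1 < c then f i.+1 else f i.+1 - 2.
have hE i : i < n.-2 -> h i = i.+1.
  apply: increasing_id => [{}i j ij jn|{}i lt]; rewrite /h.
    have ne := ne_c i.+1; have ne1 := ne_c1 i.+1.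
    have := ne_c j.+1; have := ne_c1 j.+1.
    have := no_desc i.+1 j.+1; have := small_incr i.+1 j.+1.
    have := big_incr i.+1 j.+1; have [i0|i0] := posnP i; first rewrite i0 f1.
      by do 2!case: ifP; lia.
    by do 2!case: ifP; lia.
  have := ne_c i.+1; have := ne_c1 i.+1; have := @range_f i.+1.
  by case: ifP; lia.
apply: (@eq_from_nth _ 0); first by rewrite size_mkseq size_w.
rewrite size_w => i lt; rewrite nth_mkseq //.
case: i lt => [|i] lt //=; have [e|e] := eqVneq i.+1 n.-1; first by rewrite e.
have := hE i; have := ne_c i.+1; have := ne_c1 i.+1; rewrite /h.
by do 2!case: ifP; lia.
Qed.

End Structure.

(** * Appending the largest entries *)

Lemma good_snoc n f :
  good n f -> (forall i, i < n -> f i <= f n) -> good n.+1 f.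
Proof.
move=> [F A B] top; split.
- move=> j k jk; rewrite ltnS leq_eqVlt => /predU1P[e|]; last exact: F.
  by subst k; have := top j; lia.
- move=> i j k ij jk; rewrite ltnS leq_eqVlt => /predU1P[e|]; last exact: A.
  by subst k; have := top i; have := top j; lia.
- move=> i j k l ij jk kl; rewrite ltnS leq_eqVlt => /predU1P[e|]; last exact: B.
  by subst l; have := top j; lia.
Qed.

(** A forbidden configuration ending at the new last entry needs two larger entries before it, or a
    larger one not adjacent to it. Only its immediate predecessor is larger. *)
Lemma good_snoc2 n f : good n f -> (forall i, i < n -> f i <= f n.+1) ->
  f n.+1 < f n -> good n.+2 f.
Proof.
move=> gf top lt.
have [|F A B] := good_snoc gf; first by move=> i /top; lia.
split.
- move=> j k jk; rewrite ltnS leq_eqVlt => /predU1P[e|]; last exact: F.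
  by subst k; have := top j; lia.
- move=> i j k ij jk; rewrite ltnS leq_eqVlt => /predU1P[e|]; last exact: A.
  subst k; have := top i; have := top j; have [e|] := eqVneq j n; last by lia.
  by rewrite e; lia.
- move=> i j k l ij jk kl; rewrite ltnS leq_eqVlt => /predU1P[e|]; last exact: B.
  by subst l; have := top j; lia.
Qed.

Lemma iota1_rcons n : iota 1 n.+1 = rcons (iota 1 n) n.+1.
Proof. by rewrite -[in LHS](addn1 n) iotaD cats1 add1n. Qed.

Lemma perm_rcons_iota n w :
  perm_eq (rcons w n.+1) (iota 1 n.+1) = perm_eq w (iota 1 n).
Proof. by rewrite iota1_rcons -!cats1 perm_cat2r. Qed.

Lemma perm_swap_iota n w :
  perm_eq (w ++ [:: n.+2; n.+1]) (iota 1 n.+2) = perm_eq w (iota 1 n).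
Proof.
rewrite 2!iota1_rcons -!cats1 -catA /= (permPl (_ : perm_eq _ (w ++ [:: n.+1; n.+2]))).
  by rewrite perm_cat2r.
by rewrite perm_cat2l (perm_catC [:: _] [:: _]).
Qed.

Lemma good_rcons n w : perm_eq w (iota 1 n) ->
  good n.+1 (nth 0 (rcons w n.+1)) <-> good n (nth 0 w).
Proof.
move=> pw; have sz := perm_iota_size pw.
have E i : i < n -> nth 0 (rcons w n.+1) i = nth 0 w i.
  by move=> lt; rewrite nth_rcons sz lt.
split=> [/(good_leq (leqnSn n))|gw]; first exact: eq_good.
apply: good_snoc; first by apply: eq_good gw => i /E.
move=> i lt; rewrite E // nth_rcons sz ltnn eqxx.
by have := perm_iota_range pw lt; lia.
Qed.

Lemma good_swap n w : perm_eq w (iota 1 n) ->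
  good n.+2 (nth 0 (w ++ [:: n.+2; n.+1])) <-> good n (nth 0 w).
Proof.
move=> pw; have sz := perm_iota_size pw.
have E i : i < n -> nth 0 (w ++ [:: n.+2; n.+1]) i = nth 0 w i.
  by move=> lt; rewrite nth_cat sz lt.
have En : nth 0 (w ++ [:: n.+2; n.+1]) n = n.+2 by rewrite nth_cat sz ltnn subnn.
have EnS : nth 0 (w ++ [:: n.+2; n.+1]) n.+1 = n.+1.
  by rewrite nth_cat sz ltnNge leqnSn subSnn.
split=> [gw|gw].
  by apply: eq_good E (good_leq _ gw); rewrite -addn2 leq_addr.
apply: good_snoc2; first by apply: eq_good gw => i /E.
- move=> i lt; rewrite E // EnS.
  by have := perm_iota_range pw lt; lia.
- by rewrite EnS En.
Qed.

(** * The two explicit kinds of words are in the family *)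

Lemma label2b_word_perm n c : 1 < c -> c < n.-1 -> perm_eq (label2b_word n c) (iota 1 n).
Proof.
move=> c1 cn; apply: uniq_range_perm; first exact: size_mkseq.
  rewrite map_inj_in_uniq ?iota_uniq // => i j; rewrite !mem_iota => li lj.
  by do !case: ifP; lia.
by move=> i lt; rewrite nth_mkseq //; do !case: ifP; lia.
Qed.

Lemma label2b_word_good n c : 1 < c -> c < n.-1 -> good n (nth 0 (label2b_word n c)).
Proof.
move=> c1 cn.
apply: (@eq_good _ (fun i => if i == 0 then c.+1 else if i == n.-1 then c
                  else if i < c then i else i.+2)).
  by move=> i lt; rewrite nth_mkseq.
split.
- by move=> j k jk kn /=; do !case: ifP; lia.
- by move=> i j k ij jk kn /=; do !case: ifP; lia.
- by move=> i j k l ij jk kl ln /=; do !case: ifP; lia.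
Qed.

Lemma max_first_perm n : 0 < n -> perm_eq (n :: iota 1 n.-1) (iota 1 n).
Proof. by case: n => //= n _; rewrite -[1 :: _]/(iota 1 n.+1) iota1_rcons perm_sym perm_rcons. Qed.

Lemma max_first_good n : good n (nth 0 (n :: iota 1 n.-1)).
Proof.
apply: (@eq_good _ (fun i => if i == 0 then n else i)).
  by move=> [|i] lt //=; rewrite nth_iota; lia.
split.
- by move=> j k jk kn /=; do !case: ifP; lia.
- by move=> i j k ij jk kn /=; do !case: ifP; lia.
- by move=> i j k l ij jk kl ln /=; do !case: ifP; lia.
Qed.

(** * Recursive enumeration of the family *)

(** Four classes, by the position of n and the entry after it. The guard [2 < n] prevents the word
    2, 1 from being listed twice. *)
Fixpoint words (n : nat) : seq (seq nat) :=
  match n with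
  | 0 => [:: [::]]
  | n'.+1 =>
    match n' with
    | 0 => [:: [:: 1]]
    | m.+1 =>
      [seq rcons w n | w <- words n'] ++ [seq w ++ [:: n; n'] | w <- words m]
      ++ [seq label2b_word n c | c <- iota 2 (n - 3)] ++ nseq (2 < n) (n :: iota 1 n')
    end
  end.

Lemma nat_ind2 (P : nat -> Prop) :
  P 0 -> P 1 -> (forall n, P n -> P n.+1 -> P n.+2) -> forall n, P n.
Proof.
move=> P0 P1 PS n; suff: P n /\ P n.+1 by case.
by elim: n => [|n [Pn PSn]]; split=> //; apply: PS.
Qed.

Lemma in_wordsSS n w : reflect
  [\/ exists2 u, u \in words n.+1 & w = rcons u n.+2,
      exists2 u, u \in words n & w = u ++ [:: n.+2; n.+1],
      exists2 c, 1 < c < n.+1 & w = label2b_word n.+2 c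
    | 0 < n /\ w = n.+2 :: iota 1 n.+1]
  (w \in words n.+2).
Proof.
rewrite [words _]/= -[_ ++ _]/(_ ++ _) !mem_cat mem_nseq.
apply: (iffP idP) => [/or4P[/mapP[u]|/mapP[u]|/mapP[c]|/andP[n0 /eqP ->]]|].
- by move=> uw ->; constructor 1; exists u.
- by move=> uw ->; constructor 2; exists u.
- rewrite mem_iota => cn ->; constructor 3; exists c => //; lia.
- by constructor 4; split=> //; lia.
case=> [[u uw ->]|[u uw ->]|[c cn ->]|[n0 ->]]; apply/or4P.
- by constructor 1; apply: map_f.
- by constructor 2; apply: map_f.
- by constructor 3; apply: map_f; rewrite mem_iota; lia.
- by constructor 4; rewrite eqxx; lia.
Qed.

Lemma words_good n w :
  w \in words n -> perm_eq w (iota 1 n) /\ good n (nth 0 w).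
Proof.
elim/nat_ind2: n w => [||n IH IHS] w.
- by rewrite inE => /eqP ->.
- by rewrite inE => /eqP ->; split=> //; split; lia.
move=> /in_wordsSS[[u /IHS[pu gu] ->]|[u /IH[pu gu] ->]|[c /andP[c1 cn] ->]|[n0 ->]].
- by rewrite perm_rcons_iota; split=> //; apply/good_rcons.
- by rewrite perm_swap_iota; split=> //; apply/good_swap.
- by split; [apply: label2b_word_perm | apply: label2b_word_good].
- by split; [apply: max_first_perm | apply: max_first_good].
Qed.

Lemma last2_decomp n (w : seq nat) : size w = n.+2 ->
  w = take n w ++ [:: nth 0 w n; nth 0 w n.+1].
Proof.
move=> sz; rewrite -[LHS](cat_take_drop n); congr (_ ++ _).
by rewrite (drop_nth 0) ?sz // (drop_nth 0) ?sz // drop_oversize ?sz.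
Qed.

(** The maximum is last, next to last before the second largest value, next to last before a smaller
    value, or earlier; these are the four classes, the last two by [max_penultimate] and
    [max_early]. *)
Lemma mem_words n (w : seq nat) :
  perm_eq w (iota 1 n) -> good n (nth 0 w) -> w \in words n.
Proof.
elim/nat_ind2: n w => [||n IH IHS] w pw gw; have sz := perm_iota_size pw.
- by case: w sz {pw gw}.
- case: w sz pw {gw} => [|x []] // _ /perm_mem/(_ x).
  by rewrite !inE eqxx => /esym/eqP ->.
have rg i := @perm_iota_range n.+2 w i pw.
have inj i j : i < n.+2 -> j < n.+2 -> nth 0 w i = nth 0 w j -> i = j.
  move=> li lj /eqP; rewrite nth_uniq ?sz // ?(perm_uniq pw) ?iota_uniq //.
  by move/eqP.
apply/in_wordsSS; have wE := last2_decomp sz.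
have [e|ne] := eqVneq (nth 0 w n.+1) n.+2.
  pose u := take n w ++ [:: nth 0 w n].
  have {}wE : w = rcons u n.+2 by rewrite -cats1 -catA /= -e.
  have pu : perm_eq u (iota 1 n.+1) by rewrite -perm_rcons_iota -wE.
  constructor 1; exists u => //; apply: IHS => //.
  by apply/(good_rcons pu); rewrite -wE.
have := nth_index 0 (_ : n.+2 \in w); rewrite (perm_mem pw) mem_iota1 leqnn.
move=> /(_ isT); set p := index _ _ => fp.
have pn : p < n.+2 by rewrite -sz index_mem (perm_mem pw) mem_iota1 leqnn.
have [p_lt|p_ge] := ltnP p n.
  have n0 := leq_ltn_trans (leq0n p) p_lt.
  by constructor 4; split=> //; apply: max_early => //; rewrite subn2.
have {fp p_ge} e : nth 0 w n = n.+2.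
  have [e|e] := eqVneq p n; first by rewrite -[X in nth 0 w X]e.
  by have e' : p = n.+1 by [lia]; rewrite e' in fp; rewrite fp eqxx in ne.
have [e'|ne'] := eqVneq (nth 0 w n.+1) n.+1.
  rewrite e e' in wE.
  have pu : perm_eq (take n w) (iota 1 n) by rewrite -perm_swap_iota -wE.
  constructor 2; exists (take n w) => //; apply: IH => //.
  by apply/(good_swap pu); rewrite -wE.
have := rg n.+1; have := inj n n.+1; rewrite e => /= ne_last rg_last.
have lt : nth 0 w n.+1 < n.+1 by lia.
have [|//|//|c1 wB] // := @max_penultimate n.+2 w pw gw.
by constructor 3; exists (nth 0 w n.+1); rewrite ?c1.
Qed.

(** * Last two entries in each class, and disjointness *)

Lemma nth_rcons_words n u :
  u \in words n.+1 -> nth 0 (rcons u n.+2) n.+1 = n.+2.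
Proof. by move=> /words_good[/perm_iota_size sz _]; rewrite nth_rcons sz ltnn eqxx. Qed.

Lemma nth_swap_words n u : u \in words n ->
  nth 0 (u ++ [:: n.+2; n.+1]) n = n.+2 /\ nth 0 (u ++ [:: n.+2; n.+1]) n.+1 = n.+1.
Proof.
move=> /words_good[/perm_iota_size sz _]; rewrite !nth_cat sz ltnn subnn.
by rewrite ltnNge leqnSn subSnn.
Qed.

Lemma nth_label2b_word n c : c \in iota 2 (n - 1) ->
  nth 0 (label2b_word n.+2 c) n = n.+2 /\ nth 0 (label2b_word n.+2 c) n.+1 = c.
Proof.
by rewrite mem_iota => cn; rewrite !nth_mkseq //; split; do !case: ifP; lia.
Qed.

Lemma nth_max_first n : 0 < n ->
  nth 0 (n.+2 :: iota 1 n.+1) n = n /\ nth 0 (n.+2 :: iota 1 n.+1) n.+1 = n.+1.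
Proof.
case: n => // n _; split.
- by rewrite -[LHS]/(nth 0 (iota 1 n.+2) n) nth_iota.
- by rewrite -[LHS]/(nth 0 (iota 1 n.+2) n.+1) nth_iota.
Qed.

Lemma wordsSS n : words n.+2 =
  [seq rcons w n.+2 | w <- words n.+1]
  ++ [seq w ++ [:: n.+2; n.+1] | w <- words n]
  ++ [seq label2b_word n.+2 c | c <- iota 2 (n - 1)]
  ++ nseq (0 < n) (n.+2 :: iota 1 n.+1).
Proof. by []. Qed.

(** The last two entries tell the four classes apart. Within the third class, the first entry c+1
    recovers c. *)
Lemma words_uniq n : uniq (words n).
Proof.
elim/nat_ind2: n => // n IH IHS; rewrite wordsSS.
rewrite !cat_uniq !has_cat !negb_or; apply/and3P; split.
- by rewrite map_inj_uniq //; apply: rcons_injl.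
- apply/and3P; split; apply/hasPn => w.
  + move=> /mapP[u uw ->]; apply/mapP => -[v vw].
    move/(congr1 (fun w => nth 0 w n.+1)); rewrite nth_rcons_words //.
    by have [_ ->] := nth_swap_words uw; lia.
  + move=> /mapP[c cn ->]; apply/mapP => -[v vw].
    move/(congr1 (fun w => nth 0 w n.+1)); rewrite nth_rcons_words //.
    by have [_ ->] := nth_label2b_word cn; move: cn; rewrite mem_iota; lia.
  + rewrite mem_nseq lt0b => /andP[n0 /eqP ->]; apply/mapP => -[v vw].
    move/(congr1 (fun w => nth 0 w n.+1)); rewrite nth_rcons_words //.
    by have [_ ->] := nth_max_first n0; lia.
apply/and3P; split.
- rewrite map_inj_uniq // => u v /eqP.
  by rewrite -!cat_rcons !cats0 !eqseq_rcons !eqxx !andbT => /eqP.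
- apply/andP; split; apply/hasPn => w.
  + move=> /mapP[c cn ->]; apply/mapP => -[v vw].
    move/(congr1 (fun w => nth 0 w n.+1)).
    have [_ ->] := nth_label2b_word cn; have [_ ->] := nth_swap_words vw.
    by move: cn; rewrite mem_iota; lia.
  + rewrite mem_nseq lt0b => /andP[n0 /eqP ->]; apply/mapP => -[v vw].
    move/(congr1 (fun w => nth 0 w n)).
    by have [-> _] := nth_max_first n0; have [-> _] := nth_swap_words vw; lia.
apply/and3P; split; last by case: n {IH IHS}.
- by rewrite map_inj_uniq ?iota_uniq // => c d /(congr1 (head 0)) [].
- apply/hasPn => w; rewrite mem_nseq lt0b => /andP[n0 /eqP ->].
  apply/mapP => -[c cn] /(congr1 (fun w => nth 0 w n)).
  by have [-> _] := nth_max_first n0; have [-> _] := nth_label2b_word cn; lia.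
Qed.

(** * Counting permutations by label *)

Lemma card_label n (A : {set 'S_n}) (q : pred (seq nat)) :
  (forall s, (s \in A) = (s \in fishburn_321_1423 n) && q (oneline s)) ->
  #|A| = count q (words n).
Proof.
move=> AE; rewrite -size_filter cardE -(size_map (@oneline n)).
apply/perm_size/uniq_perm.
- by rewrite (map_inj_uniq (@oneline_inj n)) enum_uniq.
- by rewrite filter_uniq ?words_uniq.
move=> w; rewrite mem_filter; apply/mapP/andP => [[s]|[qw /words_good[pw gw]]].
  rewrite mem_enum AE => /andP[/goodP gs qs] ->; split=> //.
  by apply: mem_words => //; apply/onelineP; exists s.
have /onelineP[s ws] := pw; exists s => //.
by rewrite mem_enum AE -ws qw andbT; apply/goodP; rewrite -ws.
Qed.

Lemma label_countE y n (q : pred (seq nat)) :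
  (forall s : 'S_n, has_label y s = q (oneline s)) ->
  label_count y n = count q (words n).
Proof. by move=> yq; apply: card_label => s; rewrite inE yq. Qed.

Lemma count_wordsSS n (q : pred (seq nat)) : count q (words n.+2) =
  count (fun w => q (rcons w n.+2)) (words n.+1)
  + (count (fun w => q (w ++ [:: n.+2; n.+1])) (words n)
  + (count (fun c => q (label2b_word n.+2 c)) (iota 2 (n - 1))
  + q (n.+2 :: iota 1 n.+1) * (0 < n))).
Proof. by rewrite wordsSS !count_cat !count_map count_nseq. Qed.

Lemma count_all_in (T : eqType) (q : pred T) s :
  {in s, forall x, q x} -> count q s = size s.
Proof. by move=> qs; apply/eqP; rewrite -all_count; apply/allP. Qed.

Lemma count_none_in (T : eqType) (q : pred T) s :
  {in s, forall x, ~~ q x} -> count q s = 0.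
Proof. by move=> qs; apply/eqP; rewrite -leqn0 leqNgt -has_count; apply/hasPn. Qed.

(** At length n+2 the third and fourth classes contribute n words together, also for n = 0; adding
    n+1 to the size turns the recurrence into that of [fib]. *)
Lemma size_words n : size (words n) + n.+1 = fib n.+2.
Proof.
elim/nat_ind2: n => // n IH IHS.
rewrite -[fib _]/(fib n.+3 + fib n.+2) -IH -IHS.
rewrite wordsSS !size_cat !size_map size_iota size_nseq; lia.
Qed.

(** Label (1) singles out the second class. *)
Lemma label_count1 n : label_count L1 n.+2 = size (words n).
Proof.
rewrite (@label_countE _ _ (fun w => (nth 0 w n == n.+2) && (nth 0 w n.+1 == n.+1))) //.
rewrite count_wordsSS count_none_in 1?count_all_in ?count_none_in.
- have [->|n0] := posnP n; first by rewrite muln0 !addn0.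
  by have [-> _] := nth_max_first n0; rewrite ltn_eqF //= mul0n !addn0.
- by move=> c cn; have [_ ->] := nth_label2b_word cn; move: cn; rewrite mem_iota; lia.
- by move=> u uw; have [-> ->] := nth_swap_words uw; rewrite !eqxx.
- by move=> u uw; rewrite nth_rcons_words // andbC; case: eqP; lia.
Qed.

(** Label (2b) singles out the third class, where c runs from 2 to n+1. *)
Lemma label_count2b n : label_count L2b n.+3 = n.
Proof.
rewrite (@label_countE _ _ (fun w => [&& 4 <= n.+3, nth 0 w n.+1 == n.+3
  & 1 < nth 0 w n.+2 < n.+2])) //.
rewrite count_wordsSS count_none_in 1?count_none_in 1?count_all_in.
- have [-> _] := @nth_max_first n.+1 isT; rewrite size_iota (@ltn_eqF n.+1) //=.
  lia.
- move=> c cn; have [-> ->] := nth_label2b_word cn; move: cn; rewrite mem_iota; lia.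
- by move=> u uw; have [-> ->] := nth_swap_words uw; lia.
- by move=> u uw; rewrite nth_rcons_words //; lia.
Qed.

Lemma label_count2c n : label_count L2c n.+3 = 1.
Proof.
pose q w := [exists k : 'I_n.+3, (1 <= k <= n.+3 - 2) &&
  (drop (n.+3 - (k + 2)) w == n.+3 :: rcons (iota 1 k) n.+2)].
(* Each of the first three classes violates one of these two consequences of the label. *)
have qE w : q w -> nth 0 w n.+2 = n.+2 /\ nth 0 w n.+1 <= n.+1.
  case/existsP => k /andP[k_rg /eqP e].
  have nthE i :
      nth 0 w (n.+3 - (k + 2) + i.+1) = nth 0 (rcons (iota 1 k) n.+2) i.
    by rewrite -nth_drop e.
  split.
    have := nthE k; rewrite nth_rcons size_iota ltnn eqxx.
    by rewrite (_ : _ + _ = n.+2) //; lia.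
  have := nthE k.-1; rewrite nth_rcons size_iota ifT; last by lia.
  rewrite nth_iota; last by lia.
  by rewrite (_ : _ - _ + _ = n.+1); lia.
rewrite (@label_countE _ _ q) // count_wordsSS !count_none_in.
- suff -> : q (n.+3 :: iota 1 n.+2) by [].
  (* The witness k = n+1 is the largest allowed one, for which the suffix is the whole word. *)
  have lt : n.+1 < n.+3 by lia.
  apply/existsP; exists (Ordinal lt); apply/andP; split; first by rewrite /=; lia.
  have -> : n.+3 - (Ordinal lt + 2) = 0 by rewrite /=; lia.
  by rewrite drop0 iota1_rcons eqxx.
- move=> c cn; apply/negP => /qE[]; have [-> _] := nth_label2b_word cn; lia.
- by move=> u uw; apply/negP => /qE[]; have [-> ->] := nth_swap_words uw; lia.
- by move=> u uw; apply/negP => /qE[]; rewrite nth_rcons_words //; lia.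
Qed.

(** * Descents and the remaining labels *)

Definition word_descent (n : nat) (w : seq nat) : bool :=
  [exists j : 'I_n, (j.+1 < n) && (nth 0 w j > nth 0 w j.+1)].

(** A word without descents is sorted, and sorting determines a rearrangement. *)
Lemma word_descentPn n (w : seq nat) : perm_eq w (iota 1 n) ->
  ~~ word_descent n w = (w == iota 1 n).
Proof.
move=> pw; have sz := perm_iota_size pw; apply/idP/eqP => [nd|->]; last first.
  by apply/existsP => -[j]; rewrite ltnNge => /andP[lt]; rewrite !nth_iota; lia.
apply: (sorted_eq leq_trans anti_leq) => //; last exact: iota_sorted.
apply/(sortedP 0) => i; rewrite sz => lt; rewrite leqNgt; apply: contra nd => gt.
by apply/existsP; exists (Ordinal (ltnW lt)); rewrite /= lt.
Qed.

Lemma iota_in_words n : iota 1 n \in words n.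
Proof.
apply: mem_words => //; apply: (@eq_good _ succn).
  by move=> i lt; rewrite nth_iota.
by split; lia.
Qed.

Lemma count_no_descent n : count (fun w => ~~ word_descent n w) (words n) = 1.
Proof.
rewrite (@eq_in_count _ _ (pred1 (iota 1 n))) => [|w /words_good[pw _]].
  by rewrite count_uniq_mem ?words_uniq ?iota_in_words.
by rewrite /= word_descentPn.
Qed.

Lemma label_count3 n : label_count L3 n.+2 = 1.
Proof. by rewrite -(count_no_descent n.+2); apply: label_countE. Qed.

Lemma count_last_max n :
  count (fun w => nth 0 w n.+1 == n.+2) (words n.+2) = size (words n.+1).
Proof.
rewrite count_wordsSS count_all_in ?count_none_in.
- have [->|n0] := posnP n; first by rewrite muln0 !addn0.
  by have [_ ->] := nth_max_first n0; rewrite ltn_eqF //= mul0n !addn0.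
- by move=> c cn; have [_ ->] := nth_label2b_word cn; move: cn; rewrite mem_iota; lia.
- by move=> u uw; have [_ ->] := nth_swap_words uw; lia.
- by move=> u uw; rewrite nth_rcons_words.
Qed.

(** The words ending in their maximum form the first class; the added 1 is the increasing word, the
    only one among them without a descent. *)
Lemma label_count2d n : label_count L2d n.+2 + 1 = size (words n.+1).
Proof.
rewrite (@label_countE _ _ (fun w => (nth 0 w n.+1 == n.+2) && word_descent n.+2 w)) //.
rewrite -(count_no_descent n.+2) -count_last_max -count_predUI.
rewrite [X in _ + X]count_none_in ?addn0 => [|w _ /=]; last first.
  by case: (word_descent _ _); rewrite ?andbF.
apply: eq_in_count => w /words_good[pw _] /=.
have := word_descentPn pw; case: (word_descent _ _) => [_|/esym/eqP ->].
  by rewrite andbT orbF.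
by rewrite andbF nth_iota // add1n eqxx.
Qed.

Lemma card_fishburn_words n : #|fishburn_321_1423 n| = size (words n).
Proof. by rewrite (@card_label _ _ predT) ?count_predT // => s; rewrite andbT. Qed.

Local Open Scope ring_scope.

(* The counts are compared in int, so that the subtractions are not truncated. *)
Theorem proposition7p12 :
  (forall n : nat, (2 <= n)%N ->
     (label_count L1 n)%:Z = (fib n)%:Z - n%:Z + 1) /\
  (forall n : nat, (3 <= n)%N ->
     (label_count L2b n)%:Z = n%:Z - 3) /\
  (forall n : nat, (3 <= n)%N ->
     label_count L2c n = 1%N) /\
  (forall n : nat,
     (label_count L2d n)%:Z = (fib n.+1)%:Z - n%:Z - 1) /\
  (forall n : nat, (2 <= n)%N ->
     label_count L3 n = 1%N) /\
  (forall n : nat,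
     #|fishburn_321_1423 n|%:Z = (fib n.+2)%:Z - n%:Z - 1).
Proof.
split; last split; last split; last split; last split.
- by move=> [|[|n]] // _; rewrite label_count1 -size_words; lia.
- by move=> [|[|[|n]]] // _; rewrite label_count2b; lia.
- by move=> [|[|[|n]]] // _; apply: label_count2c.
(* Lengths 0 and 1 precede the recursion; no descent exists there, and the formula gives 0. *)
- move=> [|[|n]].
  + by rewrite (@label_countE _ _ pred0).
  + rewrite (@label_countE _ _ (fun w => (nth 0%N w 0 == 1%N) && word_descent 1 w)) //.
    rewrite count_none_in // => w _; apply/nandP; right.
    by apply/existsP => -[j /andP[]].
  + by have := label_count2d n; rewrite -size_words; lia.
- by move=> [|[|n]] // _; apply: label_count3.
- by move=> n; rewrite card_fishburn_words -size_words; lia.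
Qed.
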